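(* For all odd positive integers $n$, \[ \mathsf{DT}(\mathsf{GT}_n) = 2n, \quad \mathsf{C}_{\mathsf{min}}(\mathsf{GT}_n) = 2, \quad \mathsf{InstC}(\mathsf{GT}_n) \leq 2, \] \[ \mathsf{DT}(\mathsf{OMB}_n) = n, \quad \mathsf{C}_{\mathsf{min}}(\mathsf{OMB}_n) = 1, \quad \mathsf{InstC}(\mathsf{OMB}_n) < 2. \]
   Context: $\mathsf{GT}_n:\{0,1\}^{2n}\to\{0,1\}$ is defined by $\mathsf{GT}_n(x_1,\dots,x_n,y_1,\dots,y_n)=1$ iff $\sum_{i=1}^n (2^i x_i - 2^i y_i) > 0$. $\mathsf{OMB}_n:\{0,1\}^n\to\{0,1\}$ is defined by $\mathsf{OMB}_n(x)=1$ iff $\max\{i\in[n]: x_i=1\}$ is odd, with $\mathsf{OMB}_n(0^n)=0$. For a Boolean function $f$ on $N$ variables: a deterministic decision tree is a rooted binary tree with internal nodes labeled by variables, edges labeled $0/1$, leaves labeled by outputs in $\{0,1\}$, evaluating an input by following the path determined by queried values; it computes $f$ if it outputs $f(x)$ for all $x$; $\mathcal{T}(x)$ is the number of queries on $x$. $\mathsf{DT}(f)$ is the minimum depth of a decision tree computing $f$. A certificate for $x$ is a set $S$ of variables such that $f(y)=f(x)$ for all $y$ agreeing with $x$ on $S$; $\mathsf{C}(f,x)$ is its minimum size; $\mathsf{C}_{\mathsf{min}}(f)=\min_x\mathsf{C}(f,x)$. $\mathsf{InstC}(f)=\min_{\mathcal{T}}\max_x \frac{\mathcal{T}(x)}{\mathsf{C}(f,x)}$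 over decision trees $\mathcal{T}$ computing $f$.
   Formalization: The claim C_min(GT_n) = 2 is stated only for n > 1, because it fails at n = 1: x_1 = 0 alone certifies GT_1 = 0, so C_min(GT_1) = 1; the other five claims are stated for every odd positive n. *)

(* Defs.v *)
From HB Require Import structures.
From mathcomp Require Import all_boot all_order all_algebra.
From mathcomp Require Import boolp.

Set Implicit Arguments.
Unset Strict Implicit.
Unset Printing Implicit Defensive.

Import Order.TTheory GRing.Theory Num.Theory.

Notation input N := {ffun 'I_N -> bool}.
Notation boolfun N := (input N -> bool).

Inductive dtree (N : nat) : Type :=
  | Leaf of bool
  (* [Node i T0 T1] queries variable [i] and continues in [T0] on answer 0,
     in [T1] on answer 1. *)
  | Node of 'I_N & dtree N & dtree N.

Arguments Leaf {N} _.

Section DecisionTrees.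
Variable N : nat.
Implicit Types (T : dtree N) (f : boolfun N) (x y : input N).

Fixpoint eval T x : bool :=
  match T with
  | Leaf b => b
  | Node i T0 T1 => if x i then eval T1 x else eval T0 x
  end.

Fixpoint queries T x : nat :=
  match T with
  | Leaf _ => 0
  | Node i T0 T1 => (if x i then queries T1 x else queries T0 x).+1
  end.

Fixpoint depth T : nat :=
  match T with
  | Leaf _ => 0
  | Node _ T0 T1 => (maxn (depth T0) (depth T1)).+1
  end.

Definition computes T f : Prop := forall x, eval T x = f x.

Lemma computable f : exists T, computes T f.
Proof.
suff H (k : nat) : k <= N -> forall g : boolfun N,
    (forall x y, (forall i : 'I_N, i < k -> x i = y i) -> g x = g y) ->
    exists T, computes T g.
  by apply: (H N) => // x y e; congr f; apply/ffunP => i; apply: e.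
elim: k => [|k IHk] ltkN g gP.
  by exists (Leaf (g [ffun=> false])) => x /=; apply: gP.
pose i0 := Ordinal ltkN.
pose upd b x : input N := [ffun i => if i == i0 then b else x i].
have HT b : exists T, computes T (fun x => g (upd b x)).
  apply: IHk => [|x y e]; first exact: ltnW.
  apply: gP => i; rewrite !ffunE ltnS leq_eqVlt.
  case: (eqVneq i i0) => // ne /orP[/eqP e'|/e //].
  by case/eqP: ne; apply: val_inj.
have [T0 H0] := HT false; have [T1 H1] := HT true.
exists (Node i0 T0 T1) => x /=.
case Ex: (x i0); rewrite ?H0 ?H1; congr g; apply/ffunP => i; rewrite ffunE;
  by case: (eqVneq i i0) => // ->; rewrite Ex.
Qed.

Lemma depth_optimal f :
  exists T, computes T f /\ forall T', computes T' f -> depth T <= depth T'.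
Proof.
have ex : exists d, `[< exists T, computes T f /\ depth T = d >].
  by have [T fT] := computable f; exists (depth T); apply/asboolP; exists T.
case: (ex_minnP ex) => d /asboolP[T [fT <-]] minT.
by exists T; split=> // T' fT'; apply: minT; apply/asboolP; exists T'.
Qed.

Definition DT f : nat := depth (sval (cid (depth_optimal f))).

Definition certificate f x (S : {set 'I_N}) : bool :=
  [forall y : input N, [forall i in S, y i == x i] ==> (f y == f x)].

(* The full set of variables is a certificate, so it is a legitimate starting
   point of the minimization. *)
Definition C f x : nat :=
  #|[arg min_(S < [set: 'I_N] | certificate f x S) #|S|]|.

Definition C_min f : nat := C f [arg min_(x < [ffun=> false]) C f x].

Local Open Scope ring_scope.

(* The ratios are nonnegative and there is at least one input, so the neutral
   element 0 does not affect the maximum. When [f] is constant [C f x = 0] and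
   the ratio is 0 by the convention on inverses in [rat]; otherwise [C f x] is
   positive. *)
Definition inst_ratio f T : rat :=
  \big[Num.max/0]_(x : input N) ((queries T x)%:R / (C f x)%:R).

Lemma C_le f x : (C f x <= N)%N.
Proof.
rewrite /C; case: arg_minnP => [|S _ minS].
  apply/forallP => y; apply/implyP => /forallP e; apply/eqP; congr f.
  by apply/ffunP => i; apply/eqP; move: (e i); rewrite in_setT.
by apply: leq_trans (max_card _) _; rewrite card_ord.
Qed.

Lemma inst_ratio_nat f T : exists m : nat, inst_ratio f T * (N`!)%:R = m%:R.
Proof.
rewrite /inst_ratio; elim/big_ind: _ => [|a b [m Em] [k Ek]|x _].
- by exists 0%N; rewrite mul0r.
- by case: (leP a b) => _; [exists k | exists m].
case: (posnP (C f x)) => [->|Cx_gt0]; first by exists 0%N; rewrite invr0 mulr0 mul0r.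
have /dvdnP[q ->] : (C f x %| N`!)%N by apply: dvdn_fact; rewrite Cx_gt0 C_le.
exists (queries T x * q)%N; rewrite !natrM -mulrA; congr (_ * _).
by rewrite mulrC mulfK // pnatr_eq0 -lt0n.
Qed.

Lemma inst_optimal f :
  exists T, computes T f /\
    forall T', computes T' f -> inst_ratio f T <= inst_ratio f T'.
Proof.
pose P m := `[< exists T, computes T f /\ inst_ratio f T * (N`!)%:R = m%:R >].
have ex : exists m, P m.
  have [T fT] := computable f; have [m Em] := inst_ratio_nat f T.
  by exists m; apply/asboolP; exists T.
case: (ex_minnP ex) => m /asboolP[T [fT Em]] minT.
exists T; split=> // T' fT'; have [k Ek] := inst_ratio_nat f T'.
have fact_pos : 0 < (N`!)%:R :> rat by rewrite ltr0n fact_gt0.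
rewrite -(ler_pM2r fact_pos) Em Ek ler_nat.
by apply: minT; apply/asboolP; exists T'.
Qed.

Definition InstC f : rat := inst_ratio f (sval (cid (inst_optimal f))).

End DecisionTrees.

(* The first [n] coordinates of [z] are x_1, ..., x_n and the last [n] are
   y_1, ..., y_n; the index [i : 'I_n] stands for i + 1. *)
Definition GT (n : nat) : boolfun (n + n) := fun z =>
  (0 < \sum_(i < n) (2%:Z ^+ i.+1 * (z (lshift n i))%:Z
                     - 2%:Z ^+ i.+1 * (z (rshift n i))%:Z))%R.

Arguments GT n z : clear implicits.

(* Indices are shifted to be 1-based; on the all-zero input the maximum is 0,
   which is not odd. *)
Definition OMB (n : nat) : boolfun n := fun x => odd (\max_(i < n | x i) i.+1).
Arguments OMB n x : clear implicits.

(* [x_1 = 0] alone forces GT_1 = 0, so C_min(GT_n) = 2 only holds for n > 1. *)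
Lemma C_min_GT1 : C_min (GT 1) = 1.
Proof.
have GT1 z : GT 1 z = z (lshift 1 ord0) && ~~ z (rshift 1 ord0).
  by rewrite /GT big_ord1; do 2 case: (z _).
have cT f x : certificate f x [set: 'I_2].
  apply/forallP => y; apply/implyP => /forallP e; apply/eqP; congr f.
  by apply/ffunP => i; apply/eqP; move: (e i); rewrite in_setT.
apply/eqP; rewrite eqn_leq; apply/andP; split.
  rewrite /C_min; case: arg_minnP => // x _ /(_ [ffun=> false] isT).
  move/leq_trans; apply; rewrite /C; case: arg_minnP => [|S _]; first exact: cT.
  move=> /(_ [set lshift 1 ord0]); rewrite cards1; apply.
  apply/forallP => y; apply/implyP => /forallP/(_ (lshift 1 ord0)).
  by rewrite in_set1 eqxx /= !GT1 !ffunE => /eqP ->.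
rewrite /C_min /C; case: arg_minnP => [|S cS _]; first exact: cT.
rewrite lt0n cards_eq0; apply/eqP => S0; move: cS; rewrite {}S0.
set x := arg_min _ _ _ => /forallP H.
have Hc y : GT 1 y = GT 1 x.
  apply/eqP; move/implyP: (H y); apply; apply/forallP => i.
  by rewrite in_set0.
have := Hc [ffun=> false]; have := Hc [ffun i => i == lshift 1 ord0].
by rewrite !GT1 !ffunE /= => <-.
Qed.

(* Main.v *)
Require Import Defs.
From mathcomp Require Import all_boot all_order all_algebra.
From mathcomp Require Import boolp zify.

(** Depth lower bounds: a decision tree of depth less than the number of
    variables computes a function whose top Fourier coefficient vanishes, because
    every leaf is reached by a subcube of positive dimension.  For GT and OMB this
    coefficient is nonzero: pair the inputs by flipping the least significant
    variable; the pairs on which the function changes all contribute with the same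
    sign.

    Instance bounds: both functions are computed by reading from the most
    significant position downwards until the value is known.  For GT, a
    certificate must contain a variable of each pair that was read.  For OMB, if
    the topmost 1 is at position k, a certificate must contain every second
    position above k, and also one position at most k; on the zero input it must
    contain all (n + 1) / 2 odd positions, whence the strict inequality for odd n. *)

Set Implicit Arguments.
Unset Strict Implicit.
Unset Printing Implicit Defensive.

Import Order.TTheory GRing.Theory Num.Theory.

(** * Optimality of certificates and trees *)

Section DecisionTreeBounds.
Variable N : nat.
Implicit Types (T : dtree N) (f : boolfun N) (x y z : input N) (S : {set 'I_N}).

Lemma certificateP f x S :
  reflect (forall y, {in S, y =1 x} -> f y = f x) (certificate f x S).
Proof.
apply: (iffP forallP) => [cS y yx|cS y].
  apply/eqP; apply: (implyP (cS y)); apply/forall_inP => i iS.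
  by apply/eqP; apply: yx.
by apply/implyP => /forall_inP yx; apply/eqP; apply: cS => i /yx/eqP.
Qed.

Lemma certificateT f x : certificate f x [set: 'I_N].
Proof.
by apply/certificateP => y yx; congr f; apply/ffunP => i; apply: yx.
Qed.

Lemma C_leP f x k :
  reflect (forall S, certificate f x S -> k <= #|S|) (k <= C f x).
Proof.
rewrite /C; case: arg_minnP => [|S cS minS]; first exact: certificateT.
by apply: (iffP idP) => [kS S' /minS|]; [apply: leq_trans | apply].
Qed.

Lemma C_le_card f x S : certificate f x S -> C f x <= #|S|.
Proof. by move: S; apply/C_leP. Qed.

Lemma C_min_le f x : C_min f <= C f x.
Proof. by rewrite /C_min; case: arg_minnP => // y _ /(_ x isT). Qed.

Lemma C_min_ge f k : (forall x, k <= C f x) -> k <= C_min f.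
Proof. by move=> kC; apply: kC. Qed.

Lemma DT_le f T : computes T f -> DT f <= depth T.
Proof. by rewrite /DT; case: cid => T' /= [_]; apply. Qed.

Lemma DT_ge f k : (forall T, computes T f -> k <= depth T) -> k <= DT f.
Proof. by rewrite /DT; case: cid => T' /= [fT' _]; apply. Qed.

Lemma InstC_le f T : computes T f -> (InstC f <= inst_ratio f T)%R.
Proof. by rewrite /InstC; case: cid => T' /= [_]; apply. Qed.

(** * Depth and the top Fourier coefficient *)

Definition weight x : nat := \sum_i x i.

Definition flip (i : 'I_N) x : input N := [ffun k => (k == i) (+) x k].

Lemma flipK i : involutive (flip i).
Proof. by move=> x; apply/ffunP => k; rewrite !ffunE addbA addbb. Qed.

Lemma odd_weight_flip i x : odd (weight (flip i x)) = ~~ odd (weight x).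
Proof.
rewrite /weight (bigD1 i) //= [in RHS](bigD1 i) //= ffunE eqxx.
rewrite (eq_bigr (fun k => x k : nat)) => [|k /negPf ki]; last by rewrite ffunE ki.
by rewrite !oddD; case: (x i) => //=; rewrite negbK.
Qed.

(** Summand of the unnormalised Fourier coefficient of [f] at the full set of variables. *)
Definition signed f x : int := ((-1) ^+ weight x * (f x)%:R)%R.

Lemma signed_flip f i x :
  signed f (flip i x) = (- ((-1) ^+ weight x * (f (flip i x))%:R))%R.
Proof.
rewrite /signed -signr_odd odd_weight_flip -[in RHS]signr_odd.
by case: (odd _); rewrite /= ?mulN1r ?mul1r ?opprK.
Qed.

(** [S] holds the variables fixed on the way to a node and [a] their values, so that the induction
    can run over subtrees. At a leaf some variable is free, and flipping it pairs off summands of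
    opposite sign. *)
Lemma signed_sum_subcube T S a : #|S| + depth T < N ->
  (\sum_(x : input N | [forall k in S, x k == a k]) signed (eval T) x = 0)%R.
Proof.
elim: T S a => [b|i T0 IH0 T1 IH1] S a /= ltN.
  rewrite addn0 in ltN.
  have /subsetPn[i _ iS] : ~~ ([set: 'I_N] \subset S).
    by apply/negP => /subset_leq_card; rewrite cardsT card_ord leqNgt ltN.
  set s := (\sum_(x | _) _)%R; suff : (s + s = 0)%R by lia.
  rewrite {2}/s (reindex_inj (inv_inj (flipK i))) /=.
  rewrite [X in (_ + X)%R](eq_bigl (fun x => [forall k in S, x k == a k])).
    by rewrite -big_split /= big1 // => x _; rewrite signed_flip subrr.
  move=> x; apply: eq_forallb => k; rewrite ffunE.
  by case: (eqVneq k i) => [->|//]; rewrite (negPf iS).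
have [lt0 lt1] : #|S| + (depth T0).+1 < N /\ #|S| + (depth T1).+1 < N.
  by split; apply: leq_ltn_trans ltN; rewrite leq_add2l ltnS (leq_maxl, leq_maxr).
have [iS|iS] := boolP (i \in S).
  rewrite (eq_bigr (signed (eval (if a i then T1 else T0)))) => [|x /forall_inP xa].
    by case: (a i); [apply: IH1 | apply: IH0]; rewrite -addnS ltnW.
  by rewrite /signed /= (eqP (xa i iS)); case: (a i).
(* A fresh query halves the subcube; each half fixes one more variable and has one level of depth
   less. *)
have half b : (\sum_(x : input N | [forall k in S, x k == a k] && (x i == b))
    signed (eval (Node i T0 T1)) x = 0)%R.
  pose a' k := if k == i then b else a k.
  rewrite (eq_bigl (fun x => [forall k in i |: S, x k == a' k])) => [|x].
    rewrite (eq_bigr (signed (eval (if b then T1 else T0)))) => [|x /forall_inP xa].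
      by case: b @a'=> a'; [apply: IH1 | apply: IH0]; rewrite cardsU1 iS addSnnS.
    by have := xa i (setU11 _ _); rewrite /signed /= /a' eqxx => /eqP ->; case: (b).
  apply/andP/forall_inP => [[/forall_inP xa xi] k|xa].
    rewrite /a' in_setU1; case: eqVneq => [->|_ /=] //; exact: xa.
  split; last by have := xa i (setU11 _ _); rewrite /a' eqxx.
  apply/forall_inP => k kS; have := xa k (setU1r _ kS).
  by rewrite /a'; case: (k =P i) => // ki; rewrite -ki kS in iS.
rewrite (bigID (fun x => x i)) /=.
rewrite -[RHS](addr0 0%R); congr (_ + _)%R.
  by rewrite -[RHS](half true); apply: eq_bigl => x; rewrite eqb_id.
by rewrite -[RHS](half false); apply: eq_bigl => x; rewrite eqbF_neg.
Qed.

(* The hypotheses say that, after pairing [z] with [flip i z], all nonzero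
   contributions to the top Fourier coefficient of [f] are negative. *)
Lemma DT_full f i :
  (forall z, f z -> ~~ f (flip i z) -> odd (weight z)) ->
  (exists2 z, f z & ~~ f (flip i z)) ->
  N <= DT f.
Proof.
move=> oddf [z0 fz0 fz0']; apply: DT_ge => T fT; rewrite leqNgt; apply/negP => ltN.
have := @signed_sum_subcube T set0 z0; rewrite cards0 => /(_ ltN).
rewrite (eq_bigl predT) => [|x]; last by apply/forall_inP => k; rewrite in_set0.
rewrite (eq_bigr (signed f)) => [sum0|x _]; last by rewrite /signed fT.
(* Each input occurs once as [x] and once as [flip i x], so this is twice the coefficient. *)
have pair_sum : (\sum_(x : input N) (signed f x + signed f (flip i x)) = 0)%R.
  rewrite big_split /= sum0 add0r -[RHS]sum0.
  by rewrite [in RHS](reindex_inj (inv_inj (flipK i))).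
have pair_le0 x : (signed f x + signed f (flip i x) <= 0)%R.
  rewrite signed_flip /signed; case fx: (f x); case fx': (f (flip i x)).
  - by rewrite subrr.
  - by rewrite -signr_odd oddf ?fx ?fx'.
  - have := odd_weight_flip i x; rewrite oddf ?flipK ?fx ?fx' //.
    by rewrite -signr_odd => /esym/negPf ->.
  - by rewrite subrr.
move: pair_sum; rewrite (bigD1 z0) //= => pair_sum.
have rest_le0 : (\sum_(x : input N | x != z0) (signed f x + signed f (flip i x)) <= 0)%R.
  exact: sumr_le0.
have z0_lt0 : (signed f z0 + signed f (flip i z0) < 0)%R.
  by rewrite signed_flip /signed fz0 (negPf fz0') -signr_odd oddf.
by have := ltr_leD z0_lt0 rest_le0; rewrite pair_sum addr0 ltxx.
Qed.

End DecisionTreeBounds.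

(** * Cardinality bounds from duplicate-free lists *)

Lemma inord_uniq n (s : seq nat) : uniq s -> {in s, forall k, k <= n} ->
  uniq [seq inord k : 'I_n.+1 | k <- s].
Proof.
move=> us sn; rewrite map_inj_in_uniq // => k l /sn kn /sn ln /(congr1 val).
by rewrite /= !inordK.
Qed.

Lemma uniq_leq_card (T : finType) (s : seq T) (S : {set T}) :
  uniq s -> {subset s <= S} -> size s <= #|S|.
Proof.
by move=> us sS; rewrite cardE uniq_leq_size // => x /sS; rewrite mem_enum.
Qed.

(** * Greater-than *)

Lemma sum_digits_bound (d : nat -> int) n : (forall k, `|d k| <= 1)%R ->
  (`|\sum_(k < n) 2 ^+ k.+1 * d k| < 2 ^+ n.+1)%R.
Proof.
move=> d1; elim: n => [|n IHn]; first by rewrite big_ord0.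
rewrite big_ord_recr /= (exprS _ n.+1); set p := (2 ^+ n.+1)%R in IHn *.
have p_ge0 : (0 <= p)%R by rewrite exprn_ge0.
apply: le_lt_trans (ler_normD _ _) _; rewrite mulr_natl mulr2n.
by apply: ltr_leD IHn _; rewrite normrM ger0_norm // ler_piMr.
Qed.

(** The terms below [j] sum to less than [2 ^+ j.+1] in absolute value, so the top nonzero digit, 1
    or -1, fixes the sign. *)
Lemma sum_digits_gt0 (d : nat -> int) n j : (forall k, `|d k| <= 1)%R ->
  j < n -> (forall k, j < k < n -> d k = 0%R) -> d j != 0%R ->
  (0 < \sum_(k < n) 2 ^+ k.+1 * d k)%R = (0 < d j)%R.
Proof.
move=> d1; elim: n => // n IHn jn d0 dj.
rewrite big_ord_recr /=; have [jn'|nj] := ltnP j n.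
  rewrite d0 ?jn' ?leqnn // mulr0 addr0 IHn // => k /andP[jk kn].
  by rewrite d0 // jk ltnW.
have ejn : n = j by lia.
subst j.
have := sum_digits_bound n d1; have := d1 n.
set p := (2 ^+ n.+1)%R; set s := (\sum_(k < n) _)%R => dn sp.
have : (0 < p)%R by rewrite exprn_gt0.
have /orP[/eqP ->|/eqP ->] : (d n == 1%R) || (d n == - 1)%R by lia.
  by rewrite mulr1; lia.
by rewrite mulrN1; lia.
Qed.

Section GreaterThan.
Variable m : nat.
Notation n := m.+1.
Implicit Types (x z : input (n + n)) (j p q : 'I_n) (S : {set 'I_(n + n)}).

Notation xv := (lshift n).
Notation yv := (rshift n).

Lemma GT_top z j : (forall p, j < p -> z (xv p) = z (yv p)) ->
  z (xv j) != z (yv j) -> GT n z = z (xv j).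
Proof.
move=> eqz neqz; pose d k : int :=
  ((z (xv (inord k)))%:Z - (z (yv (inord k)))%:Z)%R.
have -> : GT n z = (0 < \sum_(k < n) 2 ^+ k.+1 * d k)%R.
  by congr (_ < _)%R; apply: eq_bigr => p _; rewrite -mulrBr /d inord_val.
rewrite (@sum_digits_gt0 d n j) ?ltn_ord //.
- by rewrite /d inord_val; move: neqz; case: (z _); case: (z _).
- by move=> k; rewrite /d; case: (z _); case: (z _).
- move=> k /andP[jk kn]; rewrite /d eqz ?subrr //=; rewrite inordK //.
- by rewrite /d inord_val; move: neqz; case: (z _); case: (z _).
Qed.

Lemma GT_eq z : (forall p, z (xv p) = z (yv p)) -> GT n z = false.
Proof. by move=> eqz; rewrite /GT big1 // => p _; rewrite eqz subrr. Qed.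

Definition setpair j (b c : bool) z : input (n + n) :=
  [ffun v => if v == xv j then b else if v == yv j then c else z v].

Lemma setpair_x j b c z p :
  setpair j b c z (xv p) = if p == j then b else z (xv p).
Proof. by rewrite ffunE eq_lshift eq_lrshift; case: eqP. Qed.

Lemma setpair_y j b c z p :
  setpair j b c z (yv p) = if p == j then c else z (yv p).
Proof. by rewrite ffunE eq_rlshift eq_rshift. Qed.

Lemma GT_setpair z j b : (forall p, j < p -> z (xv p) = z (yv p)) ->
  GT n (setpair j b (~~ b) z) = b.
Proof.
move=> eqz; rewrite (@GT_top _ j) ?setpair_x ?setpair_y ?eqxx //; last by case: b.
move=> p jp; rewrite setpair_x setpair_y eqz //.
by case: eqVneq jp => // ->; rewrite ltnn.
Qed.

(** If [S] missed pair [j], setting that pair to (1,0) or (0,1) in [z] would give both values.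
    Keeping [z] apart from [x] lets the variables outside [S] be chosen so that the pairs above [j]
    agree. *)
Lemma GT_certificate_pair z x j S : {in S, z =1 x} -> certificate (GT n) x S ->
  (forall p, j < p -> z (xv p) = z (yv p)) -> (xv j \in S) || (yv j \in S).
Proof.
move=> zx /certificateP cS eqz; apply: contraT; rewrite negb_or => /andP[xS yS].
have agree b : GT n (setpair j b (~~ b) z) = GT n x.
  apply: cS => v vS; rewrite ffunE.
  case: eqVneq vS => [->|_ vS]; first by rewrite (negPf xS).
  by case: eqVneq vS => [->|_ /zx//]; rewrite (negPf yS).
by have := agree true; rewrite -(agree false) !GT_setpair.
Qed.

Definition pair_of (v : 'I_(n + n)) : 'I_n :=
  match split v with inl j => j | inr j => j end.

Lemma pair_of_x j : pair_of (xv j) = j.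
Proof. by rewrite /pair_of (unsplitK (inl j)). Qed.

Lemma pair_of_y j : pair_of (yv j) = j.
Proof. by rewrite /pair_of (unsplitK (inr j)). Qed.

Lemma mem_pair_of j S :
  (xv j \in S) || (yv j \in S) -> j \in pair_of @: S.
Proof.
by case/orP => vS; apply/imsetP; [exists (xv j) | exists (yv j)];
  rewrite ?pair_of_x ?pair_of_y.
Qed.

Lemma C_GT_ge z (j : nat) :
  (forall p, j < p -> z (xv p) = z (yv p)) -> n - j <= C (GT n) z.
Proof.
move=> eqz; apply/C_leP => S cS.
apply: leq_trans (leq_imset_card pair_of S).
rewrite -(size_iota j (n - j)) -(size_map (fun k => inord k : 'I_n)).
apply: uniq_leq_card => [|p /mapP[k]].
  by apply: inord_uniq (iota_uniq _ _) _ => k; rewrite mem_iota; lia.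
rewrite mem_iota => kn ->; apply: mem_pair_of.
apply: (@GT_certificate_pair z z) => // q; rewrite inordK; last lia.
by move=> kq; apply: eqz; lia.
Qed.

(** A set of at most one variable misses some pair. It never contains both variables of a pair, so
    free variables can copy their partners; all pairs become equal and the missed one decisive. *)
Lemma C_GT_ge2 z : 1 < n -> 2 <= C (GT n) z.
Proof.
move=> n_gt1; apply/C_leP => S cS; rewrite leqNgt ltnS; apply/negP => S1.
have /subsetPn[j _ jS] : ~~ ([set: 'I_n] \subset pair_of @: S).
  apply/negP => /subset_leq_card; rewrite cardsT card_ord leqNgt => /negP[].
  exact: leq_ltn_trans (leq_trans (leq_imset_card _ _) S1) n_gt1.
pose v p := if xv p \in S then z (xv p) else z (yv p).
pose w : input (n + n) := [ffun u => v (pair_of u)].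
case/negP: jS; apply: mem_pair_of; apply: (@GT_certificate_pair w z) => // [u uS|p _].
  rewrite ffunE /v; have [xS|] := boolP (xv (pair_of u) \in S).
    by congr (z _); apply: (card_le1_eqP S1).
  move: uS; case: (split_ordP u) => p -> pS; first by rewrite pair_of_x pS.
  by rewrite pair_of_y.
by rewrite !ffunE pair_of_x pair_of_y.
Qed.

Lemma C_min_GT : 1 < n -> C_min (GT n) = 2.
Proof.
move=> n_gt1; apply/eqP; rewrite eqn_leq C_min_ge ?andbT => [|z]; last exact: C_GT_ge2.
pose z0 : input (n + n) := [ffun=> false].
(* The value (1,0) of the most significant pair alone forces the output 1. *)
apply: leq_trans (C_min_le _ (setpair ord_max true false z0)) _.
have <- : #|[set xv (@ord_max m); yv (@ord_max m)]| = 2.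
  by rewrite cards2 eq_lrshift.
have top p : (@ord_max m < p) = false by apply/negbTE; rewrite -leqNgt leq_ord.
apply: C_le_card; apply/certificateP => y yz.
rewrite (@GT_setpair _ _ true) => [|p]; last by rewrite top.
have yx : y (xv ord_max) by rewrite yz ?set21 // setpair_x eqxx.
have yy : y (yv ord_max) = false by rewrite yz ?set22 // setpair_y eqxx.
by rewrite (@GT_top _ ord_max) ?yx ?yy // => p; rewrite top.
Qed.

(** The argument counts the unread pairs, and the top one of them is queried next. *)
Fixpoint GT_tree (k : nat) : dtree (n + n) :=
  if k is k'.+1 then
    Node (xv (inord k'))
      (Node (yv (inord k')) (GT_tree k') (Leaf false))
      (Node (yv (inord k')) (Leaf true) (GT_tree k'))
  else Leaf false.

Lemma depth_GT_tree k : depth (GT_tree k) = 2 * k.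
Proof. by elim: k => //= k ->; lia. Qed.

(** The top [n - k] pairs were read and found equal, and any certificate meets each of them; its
    other variables pay for the remaining queries, two per variable. *)
Lemma GT_treeP k z : k <= n -> (forall p, k <= p -> z (xv p) = z (yv p)) ->
  eval (GT_tree k) z = GT n z /\ queries (GT_tree k) z <= 2 * (C (GT n) z - (n - k)).
Proof.
elim: k => [|k IHk] kn eqz; first by rewrite GT_eq // => p; apply: eqz.
have above p : (inord k : 'I_n) < p -> z (xv p) = z (yv p).
  by rewrite inordK // => /eqz.
(* Pair [k] must also be met, whatever its values; this pays for its two queries and keeps the
   truncated subtraction exact. *)
have ge_nk : n - k <= C (GT n) z by apply: C_GT_ge => p; apply: eqz.
have [eqk|neqk] := eqVneq (z (xv (inord k))) (z (yv (inord k))).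
  have [||<- qk] := IHk; first exact: ltnW.
    move=> p; rewrite leq_eqVlt => /predU1P[kp|/eqz//].
    by rewrite -(inord_val p) -kp.
  by rewrite /= -eqk; case: (z _) => /=; split=> //; lia.
rewrite (@GT_top _ _ above neqk) /=.
by move: neqk; case: (z (xv _)); case: (z (yv _)) => //= _; split=> //; lia.
Qed.

Lemma GT_tree_computes : computes (GT_tree n) (GT n).
Proof. by move=> z; have [//|p|] := @GT_treeP n z; first by have := ltn_ord p; lia. Qed.

Lemma GT_tree_queries z : queries (GT_tree n) z <= 2 * C (GT n) z.
Proof.
have [//|p|_] := @GT_treeP n z; first by have := ltn_ord p; lia.
by rewrite subnn subn0.
Qed.

Lemma DT_GT : DT (GT n) = 2 * n.
Proof.
apply/eqP; rewrite eqn_leq -{1}(depth_GT_tree n) DT_le /=; last exact: GT_tree_computes.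
rewrite mul2n -addnn; apply: (@DT_full _ _ (yv ord0)) => [z fz fz'|].
  have flip_x p : flip (yv ord0) z (xv p) = z (xv p).
    by rewrite ffunE eq_lrshift.
  have flip_y p : flip (yv ord0) z (yv p) = (p == ord0) (+) z (yv p).
    by rewrite ffunE eq_rshift.
  (* Otherwise the topmost differing pair lies above position 0, survives the flip and gives both
     inputs the same value. *)
  have eqz (p : 'I_n) : 0 < p -> z (xv p) = z (yv p).
    move=> p_gt0.
    apply: contraNeq fz' => neqp.
    have [j neqj maxj] := @arg_maxnP _ p (fun q => z (xv q) != z (yv q)) val neqp.
    have j_gt0 : 0 < j by apply: leq_trans p_gt0 (maxj _ neqp).
    have above q : j < q -> z (xv q) = z (yv q).
      by move=> jq; apply: contraTeq jq => /maxj; rewrite -leqNgt.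
    have y_flip q : 0 < q -> flip (yv ord0) z (yv q) = z (yv q).
      by rewrite flip_y; case: eqVneq => // ->.
    move: fz; rewrite (@GT_top z j) // (@GT_top _ j) ?flip_x ?y_flip //.
    by move=> q jq; rewrite flip_x y_flip ?above //; lia.
  have neq0 : z (xv ord0) != z (yv ord0).
    apply: contraTneq fz => eq0; rewrite GT_eq // => p.
    by case: (posnP p) => [p0|/eqz//]; rewrite (_ : p = ord0) //; apply: val_inj.
  have x0 : z (xv ord0) by rewrite -(@GT_top z ord0).
  (* Equal pairs add an even amount to the weight and pair 0 is (1,0), so the weight is odd. *)
  rewrite /weight big_split_ord /= !big_ord_recl x0.
  rewrite (eq_bigr (fun i => z (yv (lift ord0 i)) : nat)) => [|i _]; last by rewrite eqz.
  move: neq0; rewrite x0; case: (z _) => // _.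
  by rewrite add0n !oddD -addbA addbb.
exists (setpair ord0 true false [ffun=> false]).
  by rewrite (@GT_setpair _ _ true) // => p _; rewrite !ffunE.
rewrite GT_eq // => p; rewrite ![flip _ _ _]ffunE eq_lrshift eq_rshift.
by rewrite setpair_x setpair_y !ffunE; case: eqP.
Qed.

Lemma InstC_GT : (InstC (GT n) <= 2)%R.
Proof.
apply: le_trans (InstC_le GT_tree_computes) _.
apply: bigmax_le => // z _.
have C_gt0 : 0 < C (GT n) z.
  apply: leq_trans (@C_GT_ge z m _) => [|p]; first by rewrite subSnn.
  by have := ltn_ord p; lia.
rewrite ler_pdivrMr ?ltr0n // -natrM ler_nat; exact: GT_tree_queries.
Qed.

End GreaterThan.

(** * Odd-max-bit *)

Section OddMaxBit.
Variable m : nat.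
Notation n := m.+1.
Implicit Types (x y : input n) (j p q : 'I_n) (S : {set 'I_n}).

Lemma OMB_top x j : x j -> (forall p, j < p -> ~~ x p) -> OMB n x = odd j.+1.
Proof.
move=> xj x0; rewrite /OMB; congr odd; apply/eqP; rewrite eqn_leq.
apply/andP; split; last exact: (@leq_bigmax_cond _ _ (fun i : 'I_n => i.+1)).
by apply/bigmax_leqP => p xp; rewrite ltnS leqNgt; apply/negP => /x0; rewrite xp.
Qed.

Lemma OMB_0 x : (forall p, ~~ x p) -> OMB n x = false.
Proof. by move=> x0; rewrite /OMB big_pred0 // => p; apply/negbTE. Qed.

Definition unit_input j : input n := [ffun p => p == j].

Lemma OMB_unit j : OMB n (unit_input j) = odd j.+1.
Proof.
apply: OMB_top => [|p jp]; rewrite ffunE ?eqxx //.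
by apply/eqP => pj; rewrite pj ltnn in jp.
Qed.

Definition set_bit j x : input n := [ffun p => (p == j) || x p].

(* Below, [k] is one more than the position of the topmost 1 of [x], or 0. *)
Lemma OMB_certificate_above x S k : certificate (OMB n) x S ->
  (forall p, k <= p -> ~~ x p) -> OMB n x = odd k ->
  forall p, k <= p -> odd p = odd k -> p \in S.
Proof.
move=> /certificateP cS x0 fx p kp pk; apply: contraT => pS.
have : OMB n (set_bit p x) = OMB n x.
  by apply: cS => q qS; rewrite ffunE; case: eqVneq qS => // ->; rewrite (negPf pS).
(* The index [p] stands for position [p + 1]: as topmost 1 it gives the parity opposite to [k]. *)
rewrite fx (@OMB_top _ p) ?ffunE ?eqxx //= ?pk; first by case: (odd k).
move=> q pq; rewrite ffunE negb_or x0 ?andbT; last lia.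
by apply/eqP => qp; rewrite qp ltnn in pq.
Qed.

(** If [S] had no element below [k], then [x], the zero input and the unit input at 0 would all
    vanish on [S], but the last two have different values. *)
Lemma OMB_certificate_below x S k : certificate (OMB n) x S ->
  (forall p, k <= p -> ~~ x p) -> OMB n x = odd k -> 0 < k ->
  exists2 p, p \in S & p < k.
Proof.
move=> /certificateP cS x0 fx k_gt0.
have [/existsP[p /andP[]]|] := boolP [exists p, (p \in S) && (p < k)]; first by exists p.
rewrite negb_exists => /forallP belowS.
have aboveS p : p \in S -> k <= p by have := belowS p; case: (p \in S) => //=; lia.
have cst y : {in S, forall p, ~~ y p} -> OMB n y = odd k.
  move=> y0; rewrite -fx; apply: cS => p pS.
  by rewrite (negPf (y0 p pS)) (negPf (x0 p (aboveS p pS))).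
have odd_k : OMB n (unit_input ord0) = odd k.
  apply: cst => p /aboveS; rewrite ffunE; case: eqVneq => // ->.
  by rewrite leqNgt k_gt0.
have := cst [ffun=> false]; rewrite -odd_k OMB_unit OMB_0 => [|p]; last by rewrite ffunE.
by move=> contra; have : false = true by apply: contra => p _; rewrite ffunE.
Qed.

(** The indices [k], [k + 2], ... below [n] are forced, [uphalf (n - k)] in number, and one more
    below [k] if [k] is positive. *)
Lemma C_OMB_ge x k : k <= n -> (forall p, k <= p -> ~~ x p) -> OMB n x = odd k ->
  uphalf (n - k) + (0 < k) <= C (OMB n) x.
Proof.
move=> kn x0 fx; apply/C_leP => S cS.
pose s := [seq inord (k + i.*2) : 'I_n | i <- iota 0 (uphalf (n - k))].
have us : uniq s.
  rewrite map_inj_in_uniq ?iota_uniq // => i j; rewrite !mem_iota => ni nj.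
  by move/(congr1 val); rewrite /= !inordK; lia.
have sS p : p \in s -> (k <= p) && (p \in S).
  case/mapP => i; rewrite mem_iota => ni pE.
  have pv : p = k + i.*2 :> nat by rewrite pE inordK; lia.
  have kp : k <= p by lia.
  by rewrite kp (OMB_certificate_above cS x0 fx) // pv oddD odd_double addbF.
have size_s : size s = uphalf (n - k) by rewrite size_map size_iota.
case: (posnP k) => [_|k_gt0]; rewrite -size_s ?addn0 ?addn1.
  by apply: uniq_leq_card => // p /sS/andP[].
have [q qS qk] := OMB_certificate_below cS x0 fx k_gt0.
apply: (@uniq_leq_card _ (q :: s)) => /= [|p].
  by rewrite us andbT; apply/negP => /sS/andP[]; lia.
by rewrite in_cons => /predU1P[->|/sS/andP[]].
Qed.

Fixpoint OMB_tree (k : nat) : dtree n :=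
  if k is k'.+1 then Node (inord k') (OMB_tree k') (Leaf (odd k'.+1))
  else Leaf false.

Lemma depth_OMB_tree k : depth (OMB_tree k) = k.
Proof. by elim: k => //= k ->; rewrite maxn0. Qed.

(** The term [n - k] accounts for the queries already made above. *)
Lemma OMB_treeP k x : odd n -> k <= n -> (forall p, k <= p -> ~~ x p) ->
  eval (OMB_tree k) x = OMB n x /\
  queries (OMB_tree k) x + (n - k) < 2 * C (OMB n) x.
Proof.
move=> n_odd; elim: k => [|k IHk] kn x0.
  have fx : OMB n x = false by rewrite OMB_0 // => p; apply: x0.
  (* No 1 was found in [n] queries, and [2 * uphalf n = n + 1] as [n] is odd. *)
  have := @C_OMB_ge x 0 kn x0 fx; rewrite fx /=; split=> //; lia.
rewrite /=; case: ifP => xk.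
  have fx : OMB n x = odd k.+1.
    by rewrite (@OMB_top _ _ xk) => [|p]; rewrite inordK //; apply: x0.
  (* Here [n - k] queries face [2 * (uphalf (n - k.+1) + 1)], which is at least [n - k + 1]. *)
  by have := @C_OMB_ge x k.+1 kn x0 fx; rewrite fx; split=> //; lia.
have [||-> q_lt] := IHk; [exact: ltnW | | by split=> //; lia].
move=> p; rewrite leq_eqVlt => /predU1P[kp|/x0//].
by rewrite -(inord_val p) -kp xk.
Qed.

Lemma OMB_tree_computes : odd n -> computes (OMB_tree n) (OMB n).
Proof. by move=> n_odd x; have [|p|] := @OMB_treeP n x n_odd => //; have := ltn_ord p; lia. Qed.

Lemma DT_OMB : odd n -> DT (OMB n) = n.
Proof.
move=> n_odd; apply/eqP; rewrite eqn_leq; apply/andP; split.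
  by rewrite -[leqRHS]depth_OMB_tree; apply: DT_le; apply: OMB_tree_computes.
apply: (@DT_full _ _ ord0) => [x fx fx'|]; last first.
  exists (unit_input ord0); first by rewrite OMB_unit.
  by rewrite OMB_0 // => p; rewrite !ffunE addbb.
(* A 1 above index 0 would decide both inputs alike, so [x] can only be the unit input at 0, of
   weight 1. *)
have above p : 0 < p -> ~~ x p.
  move=> p_gt0; apply: contra fx' => xp.
  have [j xj maxj] := @arg_maxnP _ p x val xp.
  have j_gt0 : 0 < j by apply: leq_trans p_gt0 (maxj _ xp).
  have x0 q : j < q -> ~~ x q by apply: contraL => /maxj; rewrite -leqNgt.
  have flip_gt0 q : 0 < q -> flip ord0 x q = x q.
    by rewrite ffunE; case: eqVneq => // ->.
  move: fx; rewrite (OMB_top xj x0) (@OMB_top _ j) ?flip_gt0 // => q jq.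
  by rewrite flip_gt0 ?x0 //; lia.
have x0 : x ord0.
  apply: contraTT fx => x0; rewrite OMB_0 // => p.
  by case: (posnP p) => [p0|/above//]; rewrite (_ : p = ord0) //; apply: val_inj.
rewrite /weight big_ord_recl x0 big1 // => p _.
by rewrite (negPf (above _ _)).
Qed.

Lemma C_min_OMB : odd n -> C_min (OMB n) = 1.
Proof.
move=> n_odd; apply/eqP; rewrite eqn_leq C_min_ge ?andbT => [|x].
  apply: leq_trans (C_min_le _ (unit_input ord_max)) _.
  rewrite -(cards1 (@ord_max m)); apply: C_le_card; apply/certificateP => y yx.
  rewrite OMB_unit (@OMB_top _ ord_max) ?yx ?set11 ?ffunE ?eqxx // => p.
  by have := ltn_ord p => /=; lia.
apply/C_leP => S /certificateP cS; rewrite card_gt0; apply/eqP => S0.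
have cst y : OMB n y = OMB n x by apply: cS => p; rewrite S0 in_set0.
have := cst (unit_input ord0); rewrite -(cst [ffun=> false]) OMB_unit OMB_0 // => p.
by rewrite ffunE.
Qed.

Lemma InstC_OMB : odd n -> (InstC (OMB n) < 2)%R.
Proof.
move=> n_odd; apply: le_lt_trans (InstC_le (OMB_tree_computes n_odd)) _.
apply: bigmax_lt => // x _.
have [//|p|_ q_lt] := @OMB_treeP n x n_odd; first by have := ltn_ord p; lia.
rewrite ltr_pdivrMr ?ltr0n -?natrM ?ltr_nat; lia.
Qed.

End OddMaxBit.

Theorem theorem5p3 (n : nat) (n_gt0 : 0 < n) (n_odd : odd n) :
  [/\ DT (GT n) = 2 * n,
      (1 < n -> C_min (GT n) = 2) &
      (InstC (GT n) <= 2)%R] /\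
  [/\ DT (OMB n) = n,
      C_min (OMB n) = 1 &
      (InstC (OMB n) < 2)%R].
Proof.
case: n n_gt0 n_odd => // m _ n_odd; split; split.
- exact: DT_GT.
- exact: C_min_GT.
- exact: InstC_GT.
- exact: DT_OMB.
- exact: C_min_OMB.
- exact: InstC_OMB.
Qed.
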